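(* Let $v=(v(n))_{n=1}^\infty$ and $w=(w(n))_{n=1}^\infty$ be two bounded, strictly positive sequences. (i) The Cesàro operator $\mathsf{C}$ maps $\ell_1(v)$ continuously into $\ell_1(w)$ if and only if $$M_{v,w}:=\sup_{n\in\mathbb{N}}\frac{1}{v(n)}\sum_{m=n}^\infty \frac{w(m)}{m}<\infty.$$ In this case, the operator norm of $\mathsf{C}\colon \ell_1(v)\to\ell_1(w)$ is $\|\mathsf{C}\|=M_{v,w}$. (ii) $\mathsf{C}$ maps $\ell_1(v)$ compactly into $\ell_1(w)$ if and only if $$\lim_{n\to\infty}\frac{1}{v(n)}\sum_{m=n}^\infty \frac{w(m)}{m}=0.$$
   Context: The discrete Cesàro operator $\mathsf{C}\colon\mathbb{C}^{\mathbb{N}}\to\mathbb{C}^{\mathbb{N}}$ is the linear map $\mathsf{C}x:=\left(\frac{x_1+\dots+x_n}{n}\right)_{n\in\mathbb{N}}$ for $x=(x_n)_{n\in\mathbb{N}}$, with $\mathbb{N}=\{1,2,\dots\}$. For a bounded, strictly positive sequence $w=(w(n))_{n=1}^\infty$, $\ell_1(w):=\{x\in\mathbb{C}^{\mathbb{N}}\colon \sum_{n=1}^\infty w(n)|x_n|<\infty\}$, a Banach space for the norm $\|x\|_{1,w}:=\sum_{n=1}^\infty w(n)|x_n|$. ''$\mathsf{C}$ maps $\ell_1(v)$ continuously (resp. compactly) into $\ell_1(w)$'' means that $\mathsf{C}(\ell_1(v))\subseteq\ell_1(w)$ and the restriction $\mathsf{C}\colon\ell_1(v)\to\ell_1(w)$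 is a continuous (resp. compact) linear operator. *)

(* Defs.v *)
From HB Require Import structures.
From mathcomp Require Import all_boot all_order all_algebra.
From mathcomp Require Import all_classical all_reals all_analysis.
From mathcomp Require Import complex.

Set Implicit Arguments.
Unset Strict Implicit.
Unset Printing Implicit Defensive.

Import Order.TTheory GRing.Theory Num.Theory ComplexField.Normc.
Import numFieldNormedType.Exports.

Local Open Scope classical_set_scope.
Local Open Scope complex_scope.
Local Open Scope ring_scope.

(* Sequences are indexed by [nat] instead of {1, 2, ...}: the term of index
   [n] stands for the (n+1)-st term, so a factor 1/n becomes [n.+1%:R^-1]. *)

Record weight (R : realType) := Weight {
  weight_fun :> nat -> R;
  weight_gt0 : forall n, 0 < weight_fun n;
  weight_bounded : bounded_fun weight_fun }.

Section l1_space.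
Context {R : realType}.
Implicit Types (w : weight R) (x y : nat -> R[i]).

Definition l1sum w x : \bar R := (\sum_(0 <= n <oo) (w n * normc (x n))%:E)%E.

Definition l1_pred w : {pred nat -> R[i]} := mem [set x | (l1sum w x < +oo)%E].

Let normc_ge0 (z : R[i]) : 0 <= normc z.
Proof. by case: z => a b; exact: sqrtr_ge0. Qed.

Let wx_ge0 w x n : 0 <= w n * normc (x n).
Proof. by rewrite mulr_ge0 ?(ltW (weight_gt0 _ _)). Qed.

Lemma l1sum_ge0 w x : (0 <= l1sum w x)%E.
Proof. by apply: nneseries_ge0 => n _ _; rewrite lee_fin. Qed.

Lemma l1sumD w x y : (l1sum w (x + y)%R <= l1sum w x + l1sum w y)%E.
Proof.
rewrite /l1sum -nneseriesD; [|by move=> n _ _; rewrite lee_fin..].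
apply: lee_nneseries => n _; first by move=> _; rewrite lee_fin.
by rewrite -EFinD lee_fin -mulrDr ler_wpM2l ?(ltW (weight_gt0 _ _))// le_normcD.
Qed.

Lemma l1sumZ w (a : R[i]) x : l1sum w (a *: x) = ((normc a)%:E * l1sum w x)%E.
Proof.
rewrite /l1sum -nneseriesZl//; last by move=> n _; rewrite lee_fin.
by apply: eq_eseriesr => n _; rewrite -EFinM normcM mulrCA.
Qed.

Lemma l1_submod_closed w : submod_closed (l1_pred w).
Proof.
split=> [|a x y].
  rewrite inE /= /l1sum eseries0// => n _ _.
  by rewrite normc0 mulr0.
rewrite !inE /= => xw yw; apply: (le_lt_trans (l1sumD _ _ _)).
by rewrite l1sumZ lte_add_pinfty// lte_mul_pinfty// lee_fin.
Qed.

HB.instance Definition _ w :=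
  GRing.isSubmodClosed.Build R[i] (nat -> R[i]) (l1_pred w) (l1_submod_closed w).

Record l1 w := L1 { l1_val :> nat -> R[i]; l1_valP : l1_val \in l1_pred w }.

Section l1_normed.
Variable w : weight R.

HB.instance Definition _ := [isSub for @l1_val w].
HB.instance Definition _ := [Choice of l1 w by <:].
HB.instance Definition _ := [SubChoice_isSubLmodule of l1 w by <:].

Definition l1norm (x : l1 w) : R := fine (l1sum w x).

Lemma l1normE (x : l1 w) : (l1norm x)%:E = l1sum w x.
Proof.
rewrite /l1norm fineK// ge0_fin_numE ?l1sum_ge0//.
by have := l1_valP x; rewrite inE.
Qed.

(* A normed module over [R[i]] has its norm in [R[i]]. *)
Let nm (x : l1 w) : R[i] := (l1norm x)%:C.

Let nmD (x y : l1 w) : nm (x + y) <= nm x + nm y.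
Proof.
by rewrite /nm -rmorphD /= lecR -lee_fin EFinD !l1normE l1sumD.
Qed.

Let nmZ (a : R[i]) (x : l1 w) : nm (a *: x) = `|a| * nm x.
Proof.
rewrite /nm normc_def; case: a => a b /=; rewrite -rmorphM /=; congr (_%:C).
by apply: EFin_inj; rewrite EFinM !l1normE l1sumZ.
Qed.

Let nm0 (x : l1 w) : nm x = 0 -> x = 0.
Proof.
move=> nx0; have x0 : l1sum w x = 0%E.
  by rewrite -l1normE; move: nx0; rewrite /nm => -[->].
apply/val_inj/funext => n; apply: eq0_normc; apply/eqP.
have : ((w n * normc (x n))%:E <= 0)%E.
  rewrite -x0 /l1sum (@nneseriesD1 _ _ n)//; last by move=> k; rewrite lee_fin.
  by rewrite leeDl// nneseries_ge0// => k _ _; rewrite lee_fin.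
rewrite lee_fin pmulr_rle0 ?weight_gt0// => le0.
by rewrite eq_le le0 normc_ge0.
Qed.

HB.instance Definition _ := Lmodule_isNormed.Build R[i] (l1 w) nmD nmZ nm0.

Lemma l1_normE (x : l1 w) : `|x| = (l1norm x)%:C.
Proof. by []. Qed.

End l1_normed.
End l1_space.

Section operators.
Context {R : realType} {U V : normedModType R[i]}.
Implicit Type f : {linear U -> V}.

Definition opnorm f : \bar R :=
  ereal_sup [set (complex.Re `|f x|)%:E | x in [set x | `|x| <= 1]].

Definition compact_operator f :=
  forall B : set U, bounded_set B -> precompact (f @` B).

End operators.

Section cesaro.
Context {R : realType}.

Definition cesaro (x : nat -> R[i]) : nat -> R[i] :=
  fun n => (\sum_(k < n.+1) x k) / n.+1%:R.

Definition cesaro_maps (v w : weight R) :=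
  forall x : l1 v, cesaro x \in l1_pred w.

Section cesaro_restr.
Variables (v w : weight R) (vw : cesaro_maps v w).

Definition cesaro_restr (x : l1 v) : l1 w := L1 (vw x).

Let cesaro_restr_linear : linear cesaro_restr.
Proof.
move=> a x y; apply/val_inj/funext => n /=.
rewrite /cesaro /= big_split -scaler_sumr /= mulrDl.
by rewrite -scalerAl.
Qed.

HB.instance Definition _ :=
  GRing.isLinear.Build R[i] (l1 v) (l1 w) _ cesaro_restr cesaro_restr_linear.

End cesaro_restr.

Definition cesaro_continuous (v w : weight R) :=
  exists vw : cesaro_maps v w, continuous (cesaro_restr vw).

Definition cesaro_compact (v w : weight R) :=
  exists vw : cesaro_maps v w, compact_operator (cesaro_restr vw).

(* The tail sums, and hence [Mvw], take the value [+oo] when they diverge. *)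
Definition weighted_tail (v w : weight R) (n : nat) : \bar R :=
  ((v n)^-1%:E * \sum_(n <= m <oo) (w m / m.+1%:R)%:E)%E.

Definition Mvw (v w : weight R) : \bar R := ereal_sup (range (weighted_tail v w)).

End cesaro.

(* Main.v *)
(** Interchanging sums gives
      ||C x||_w <= \sum_k v_k |x_k| T_k,   T_k := v_k^-1 \sum_(m >= k) w_m / m,
    with equality for x = e_k / v_k, a vector of norm 1 in l1(v).  Hence C is
    bounded iff M = sup_k T_k is finite, and then its norm is M.
    If T --> 0, the same inequality shows that, on a ball of l1(v), C is
    continuous from the topology of coordinatewise convergence to l1(w); the
    ball is compact for that topology by Tychonoff's theorem, so its image is
    compact.  Conversely, the vectors C (e_k / v_k) have norm T_k and their
    coordinates are eventually 0, so 0 is their only possible cluster point;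
    if they all lie in a compact set, then T_k --> 0. *)

Require Import Defs.
From mathcomp Require Import all_boot all_order all_algebra.
From mathcomp Require Import all_classical all_reals all_analysis.
From mathcomp Require Import complex.
Import Order.TTheory GRing.Theory Num.Theory ComplexField.Normc.
Import numFieldNormedType.Exports.
(* Overrides the [cesaro] of MathComp-Analysis. *)
Import Defs.
Local Open Scope classical_set_scope.
Local Open Scope complex_scope.
Local Open Scope ring_scope.

Section cesaro_l1.
Context {R : realType}.
Variables v w : weight R.
Implicit Types x : nat -> R[i].

(** * Moduli and weighted sums *)

Lemma normc_ge0 (z : R[i]) : 0 <= normc z.
Proof. by case: z => a b; exact: sqrtr_ge0. Qed.

Lemma weight_ge0 (u : weight R) n : 0 <= u n.
Proof. exact/ltW/weight_gt0. Qed.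

Lemma weight_normc_ge0 (u : weight R) x n : (0 <= (u n * normc (x n))%:E)%E.
Proof. by rewrite lee_fin mulr_ge0 ?weight_ge0 ?normc_ge0. Qed.

Lemma normc_nat (n : nat) : normc (n%:R : R[i]) = n%:R.
Proof.
rewrite -(rmorph_nat (@real_complex R)) /= expr0n addr0.
by rewrite sqrtr_sqr normr_nat.
Qed.

Lemma normc_sum n (F : nat -> R[i]) :
  normc (\sum_(k < n) F k) <= \sum_(k < n) normc (F k).
Proof.
elim/big_ind2 : _ => [|a b c d ab cd|//]; first by rewrite normc0.
exact: (le_trans (le_normcD _ _) (lerD _ _)).
Qed.

Lemma l1sum_coord_le (u : weight R) x k : ((u k * normc (x k))%:E <= l1sum u x)%E.
Proof.
rewrite /l1sum (@nneseriesD1 _ _ k)//; last by move=> *; exact: weight_normc_ge0.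
by rewrite leeDl// nneseries_ge0// => i _ _; exact: weight_normc_ge0.
Qed.

Lemma tail_term_ge0 m : (0 <= (w m / m.+1%:R)%:E)%E.
Proof. by rewrite lee_fin divr_ge0 ?weight_ge0. Qed.

(** Moving the condition [n <= m] into the terms makes every tail a series starting at 0, ready for
    an interchange of sums or a termwise comparison. *)
Lemma tail_mkcond n (a : R) : 0 <= a ->
  (a%:E * \sum_(n <= m <oo) (w m / m.+1%:R)%:E =
   \sum_(0 <= m <oo) if (n <= m)%N then (w m / m.+1%:R * a)%:E else 0)%E.
Proof.
move=> a0; rewrite eseries_cond -nneseriesZl; last by move=> *; exact: tail_term_ge0.
rewrite eseries_mkcond; apply: eq_eseriesr => m _ /=.
by case: ifP => // _; rewrite -EFinM mulrC.
Qed.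

Lemma weighted_tail_ge0 n : (0 <= weighted_tail v w n)%E.
Proof.
rewrite mule_ge0 ?lee_fin ?invr_ge0 ?weight_ge0//.
by apply: nneseries_ge0 => m _ _; exact: tail_term_ge0.
Qed.

(** * The basic estimate and the vectors that attain it *)

(** The triangle inequality bounds the left side by the double series of w_m |x_k| / (m+1) over k <=
    m. Interchanging the nonnegative sums leaves the tail from k, and [v k] cancels the inverse
    weight in [weighted_tail]. *)
Lemma l1sum_cesaro_le x : (l1sum w (cesaro x) <=
  \sum_(0 <= k <oo) (v k * normc (x k))%:E * weighted_tail v w k)%E.
Proof.
pose a m k : \bar R :=
  (if (k <= m)%N then (w m / m.+1%:R * normc (x k))%:E else 0)%E.
have a0 m k : (0 <= a m k)%E.
  rewrite /a; case: ifP => // _.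
  by rewrite lee_fin mulr_ge0 ?normc_ge0// -lee_fin tail_term_ge0.
rewrite (_ : (\sum_(0 <= k <oo) _ = \sum_(0 <= k <oo) \sum_(0 <= m <oo) a m k)%E);
    last first.
  apply: eq_eseriesr => k _; rewrite -tail_mkcond ?normc_ge0//.
  rewrite /weighted_tail muleA -EFinM mulrAC mulfV ?mul1r//.
  by rewrite gt_eqF ?weight_gt0.
rewrite -nneseries_interchange//; apply: lee_nneseries.
  by move=> *; exact: weight_normc_ge0.
move=> m _; rewrite (le_trans _ (nneseries_lim_ge m.+1 _))//.
rewrite big_mkord /a (eq_bigr (fun k : 'I_m.+1 =>
    (w m / m.+1%:R * normc (x k))%:E)); last by move=> k _; rewrite -ltnS ltn_ord.
rewrite sumEFin lee_fin -mulr_sumr /cesaro normcM normcV normc_nat -mulrA.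
by rewrite ler_wpM2l ?weight_ge0// mulrC ler_wpM2l ?invr_ge0// normc_sum.
Qed.

Lemma l1sum_cesaro_le_scale x (K : R) : (forall k, weighted_tail v w k <= K%:E)%E ->
  (l1sum w (cesaro x) <= K%:E * l1sum v x)%E.
Proof.
move=> TK; apply: (le_trans (l1sum_cesaro_le x)).
rewrite -nneseriesZl; last by move=> *; exact: weight_normc_ge0.
apply: lee_nneseries => k _.
  by move=> _; rewrite mule_ge0 ?weight_normc_ge0 ?weighted_tail_ge0.
by rewrite muleC lee_wpmul2r ?weight_normc_ge0.
Qed.

(** Dividing e_k by [v k] normalises it in l1(v). *)
Definition delta_seq k : nat -> R[i] := fun n => if n == k then ((v k)^-1)%:C else 0.

Lemma normc_real (a : R) : 0 <= a -> normc a%:C = a.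
Proof. by move=> a0; rewrite /= expr0n addr0 sqrtr_sqr ger0_norm. Qed.

Lemma l1sum_delta_seq k : l1sum v (delta_seq k) = 1%E.
Proof.
rewrite /l1sum (@nneseriesD1 _ _ k)//; last by move=> *; exact: weight_normc_ge0.
rewrite eseries0 => [|n _ nk]; last by rewrite /delta_seq (negbTE nk) normc0 mulr0.
rewrite /delta_seq eqxx normc_real ?invr_ge0 ?weight_ge0//.
by rewrite mulfV ?adde0// gt_eqF ?weight_gt0.
Qed.

Lemma delta_l1P k : delta_seq k \in l1_pred v.
Proof. by rewrite inE /= l1sum_delta_seq ltry. Qed.

Lemma cesaro_delta_seq k n :
  cesaro (delta_seq k) n = if (k <= n)%N then ((v k)^-1)%:C / n.+1%:R else 0.
Proof.
rewrite /cesaro /delta_seq -big_mkcond /= -(big_mkord (fun i => i == k) (fun=> _)).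
case: leqP => kn; last first.
  rewrite big_nat_cond big_pred0 ?mul0r// => i.
  by apply/negP => /andP[/andP[_]]; rewrite ltnS => + /eqP ik; rewrite ik leqNgt kn.
rewrite big_mkcond (bigD1_seq k) ?iota_uniq ?mem_index_iota ?ltnS//= eqxx.
by rewrite big1 ?addr0// => i /negbTE ->.
Qed.

(** Each tail is thus the norm of the image of a unit vector, the source of all lower bounds on the
    operator. *)
Lemma l1sum_cesaro_delta_seq k :
  l1sum w (cesaro (delta_seq k)) = weighted_tail v w k.
Proof.
rewrite /weighted_tail tail_mkcond ?invr_ge0 ?weight_ge0//.
apply: eq_eseriesr => n _; rewrite cesaro_delta_seq.
case: ifP => _; last by rewrite normc0 mulr0.
rewrite normcM normcV normc_nat normc_real ?invr_ge0 ?weight_ge0//.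
by rewrite mulrA mulrAC.
Qed.


(** * Continuity and the operator norm *)

Lemma l1norm_cesaroE (vw : cesaro_maps v w) (x : l1 v) :
  (l1norm (cesaro_restr vw x))%:E = l1sum w (cesaro x).
Proof. exact: l1normE. Qed.

(** Comparable complex numbers have equal imaginary parts, so positive radii and bounds in [R[i]]
    are real. *)
Lemma complex_gt0 (e : R[i]) : 0 < e -> exists2 d : R, 0 < d & e = d%:C.
Proof. by case: e => a b; rewrite ltcE /= => /andP[/eqP -> a0]; exists a. Qed.

Lemma l1norm_cesaro_le (vw : cesaro_maps v w) (K : R) (x : l1 v) :
  (forall k, weighted_tail v w k <= K%:E)%E ->
  l1norm (cesaro_restr vw x) <= K * l1norm x.
Proof.
move=> TK; rewrite -lee_fin l1norm_cesaroE (le_trans (l1sum_cesaro_le_scale _ _ TK))//.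
by rewrite EFinM l1normE.
Qed.

Lemma weighted_tail_le_Mvw k : (weighted_tail v w k <= Mvw v w)%E.
Proof. by apply: ereal_sup_ubound; exists k. Qed.

Lemma Mvw_ge0 : (0 <= Mvw v w)%E.
Proof. exact: le_trans (weighted_tail_ge0 0) (weighted_tail_le_Mvw 0). Qed.

Lemma Mvw_lty_bound : (Mvw v w < +oo)%E ->
  exists2 K : R, 0 <= K & Mvw v w = K%:E.
Proof.
move=> Moo; exists (fine (Mvw v w)); first by rewrite fine_ge0 ?Mvw_ge0.
by rewrite fineK// ge0_fin_numE ?Mvw_ge0.
Qed.

Lemma Mvw_lty_maps : (Mvw v w < +oo)%E -> cesaro_maps v w.
Proof.
move=> /Mvw_lty_bound[K K0 MK] x; rewrite inE /=.
apply: (@le_lt_trans _ _ (K%:E * l1sum v x)%E).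
  by apply: l1sum_cesaro_le_scale => k; rewrite -MK weighted_tail_le_Mvw.
by rewrite -l1normE -EFinM ltry.
Qed.

Lemma Mvw_lty_continuous (vw : cesaro_maps v w) :
  (Mvw v w < +oo)%E -> continuous (cesaro_restr vw).
Proof.
move=> /Mvw_lty_bound[K K0 MK].
apply/linear_bounded_continuous/bounded_funP => r; exists (K%:C * r) => x xr.
apply: (@le_trans _ _ (K%:C * `|x|)); last by rewrite ler_wpM2l// lecR.
rewrite !l1_normE -rmorphM lecR; apply: l1norm_cesaro_le => k.
by rewrite -MK weighted_tail_le_Mvw.
Qed.

Definition delta_l1 k : l1 v := L1 (delta_l1P k).

Lemma l1norm_delta_seq k : l1norm (delta_l1 k) = 1.
Proof. by apply: EFin_inj; rewrite l1normE l1sum_delta_seq. Qed.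

Lemma l1norm_cesaro_delta_seq (vw : cesaro_maps v w) k :
  (l1norm (cesaro_restr vw (delta_l1 k)))%:E = weighted_tail v w k.
Proof. by rewrite l1norm_cesaroE l1sum_cesaro_delta_seq. Qed.

(** A bound for the operator, tested on the unit vectors [delta_l1 k], bounds every tail. *)
Lemma continuous_Mvw_lty (vw : cesaro_maps v w) :
  continuous (cesaro_restr vw) -> (Mvw v w < +oo)%E.
Proof.
move=> /linear_bounded_continuous/linear_boundedP/pinfty_ex_gt0.
move=> [_ /complex_gt0[r r0 ->] fr].
apply: (@le_lt_trans _ _ r%:E); last exact: ltry.
apply: ub_ereal_sup => _ [k _ <-]; rewrite -l1norm_cesaro_delta_seq lee_fin.
have := fr (delta_l1 k).
by rewrite !l1_normE -rmorphM lecR l1norm_delta_seq mulr1.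
Qed.

(** The scaled estimate on the unit ball gives the upper bound; the vectors [delta_l1 k] lie in that
    ball and give the lower one. *)
Lemma opnorm_cesaro (vw : cesaro_maps v w) : opnorm (cesaro_restr vw) = Mvw v w.
Proof.
apply/eqP; rewrite eq_le; apply/andP; split.
  apply: ub_ereal_sup => _ [x x1 <-]; rewrite l1_normE [complex.Re _]/=.
  have [Moo|] := ltP (Mvw v w) +oo%E; last by rewrite leye_eq => /eqP ->; rewrite leey.
  have [K K0 MK] := Mvw_lty_bound Moo; rewrite MK lee_fin.
  apply: (@le_trans _ _ (K * l1norm x)).
    by apply: l1norm_cesaro_le => k; rewrite -MK weighted_tail_le_Mvw.
  by move: x1; rewrite /= l1_normE -[1]/(1%:C) lecR => x1; rewrite ler_piMr.
apply: ub_ereal_sup => _ [k _ <-]; rewrite -(l1norm_cesaro_delta_seq vw).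
apply: ereal_sup_ubound; exists (delta_l1 k); last by rewrite l1_normE.
by rewrite /= l1_normE l1norm_delta_seq.
Qed.

(** * Compactness forces the tails to tend to 0 *)

Lemma l1_coord_le (x : l1 w) m : w m * normc (x m) <= l1norm x.
Proof. by rewrite -lee_fin l1normE l1sum_coord_le. Qed.

Lemma l1_norm_lt (x : l1 w) (e : R) : (`|x| < e%:C) = (l1norm x < e).
Proof. by rewrite l1_normE ltcR. Qed.

Lemma compact_tail_cvg0 : cesaro_compact v w ->
  weighted_tail v w n @[n --> \oo] --> 0%E.
Proof.
move=> [vw cpt]; pose y k := cesaro_restr vw (delta_l1 k).
have bB : bounded_set (range delta_l1).
  exists 1; split=> // M /ltW M1 _ [k _ <-].
  by rewrite /= l1_normE l1norm_delta_seq.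
have [C yC [cC _]] := cpt _ bB.
rewrite (_ : weighted_tail v w = fun n => (l1norm (y n))%:E); last first.
  by apply/funext => n; rewrite l1norm_cesaro_delta_seq.
apply/fine_cvgP; split; first exact: nearW.
apply/cvgrPdist_lt => e e0 /=.
(* In this form of compactness, a property valid near each z of [C] for n near infinity holds on all
   of [C] at once for n near infinity. *)
have /compact_near_coveringP cov := cC.
(* For z != 0, the points near z differ from y n as soon as n > m, where
   z m != 0, since then y n m = 0. *)
have cvr : forall z, C z -> \forall z' \near z & n \near \oo, z' = y n -> l1norm z' < e.
  (* Near z = 0 the norm is below [e], whatever n is. *)
  move=> z _; have [->|z0] := eqVneq z 0.
    exists ([set z' | `|0 - z'| < e%:C], setT); first split; last first.
    - by move=> [z' n] [/= + _ _]; rewrite sub0r normrN l1_norm_lt.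
    - exact: filterT.
    - apply: (@cvgr_dist_lt _ _ _ (nbhs (0 : l1 w)) _ id 0 _) => //.
      by rewrite ltcR.
  have [m zm] : exists m, z m != 0.
    apply/not_existsP => zn; move/eqP: z0; apply.
    by apply/val_inj/funext => m; move/negP/negPn/eqP: (zn m).
  have d0 : 0 < w m * normc (z m).
    rewrite mulr_gt0 ?weight_gt0// lt_neqAle normc_ge0 eq_sym andbT.
    by apply: contraNN zm => /eqP/eq0_normc ->.
  (* The radius is the share of coordinate m in the norm of z. If z' = [y n] with n > m, then z - z'
     has m-th coordinate [z m], so its norm is at least the radius: a contradiction. *)
  exists ([set z' | `|z - z'| < (w m * normc (z m))%:C], [set n | (m < n)%N]).
    split; last by exists m.+1.
    apply: (@cvgr_dist_lt _ _ _ (nbhs (z : l1 w)) _ id z _) => //.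
    by rewrite ltcR.
  move=> [z' n] /= [+ mn] z'E; rewrite l1_norm_lt => /(le_lt_trans (l1_coord_le _ m)).
  have -> : (z - z') m = z m.
    by rewrite z'E -[LHS]/(z m - cesaro (delta_seq n) m) cesaro_delta_seq leqNgt mn subr0.
  by rewrite ltxx.
have := cov _ _ (fun n z => z = y n -> l1norm z < e) eventually_filter cvr.
apply: filterS => n nC.
rewrite sub0r normrN ger0_norm; last by rewrite -lee_fin l1normE l1sum_ge0.
by apply: nC => //; apply: yC; exists (delta_l1 n) => //; exists n.
Qed.

(** * Tails tending to 0 are bounded *)

(** From some [n0] on the tails are at most 1. Finiteness at [n0] makes the whole series of w_m /
    (m+1) converge, and this bounds the finitely many earlier tails. *)
Lemma tail_cvg0_Mvw_lty :
  weighted_tail v w n @[n --> \oo] --> 0%E -> (Mvw v w < +oo)%E.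
Proof.
move=> /fine_cvgP[[N _ fin_tail] /cvgrPdist_lt/(_ 1 ltr01)[N' _ lt1]].
pose n0 := maxn N N'.
have le1 k : (n0 <= k)%N -> (weighted_tail v w k <= 1)%E.
  rewrite geq_max => /andP[Nk N'k].
  rewrite -(fineK (fin_tail _ Nk)) lee_fin ltW// (le_lt_trans _ (lt1 _ N'k))//=.
  by rewrite sub0r normrN ler_norm.
pose tl n := (\sum_(n <= m <oo) (w m / m.+1%:R)%:E)%E.
have tl_ge0 n : (0 <= tl n)%E by apply: nneseries_ge0 => *; exact: tail_term_ge0.
have tl0_fin : tl 0%N \is a fin_num.
  rewrite ge0_fin_numE// /tl (@nneseries_split _ _ 0 n0); last first.
    by move=> *; exact: tail_term_ge0.
  rewrite add0n sumEFin lte_add_pinfty ?ltry//.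
  have := le1 _ (leqnn n0); rewrite /weighted_tail lee_pdivrMl ?weight_gt0//.
  by move=> /le_lt_trans; apply; rewrite mule1 ltry.
have tl_le n : (tl n <= tl 0%N)%E.
  rewrite /tl eseries_cond; apply: subset_lee_nneseries => // i _.
  exact: tail_term_ge0.
(* A sum of nonnegative bounds replaces their maximum over i < [n0]. *)
pose B := \sum_(i < n0) (v i)^-1 * fine (tl 0%N).
have B0 (i : 'I_n0) : 0 <= (v i)^-1 * fine (tl 0%N).
  by rewrite mulr_ge0 ?invr_ge0 ?weight_ge0 ?fine_ge0.
apply: (@le_lt_trans _ _ (B + 1)%:E); last exact: ltry.
apply: ub_ereal_sup => _ [k _ <-]; have [kn|nk] := ltnP k n0; last first.
  by rewrite (le_trans (le1 _ nk))// lee_fin lerDr sumr_ge0.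
apply: (@le_trans _ _ ((v k)^-1 * fine (tl 0%N))%:E).
  rewrite EFinM fineK// /weighted_tail.
  by rewrite lee_wpmul2l ?tl_le ?lee_fin ?invr_ge0 ?weight_ge0.
rewrite lee_fin /B (bigD1 (Ordinal kn))//= -addrA lerDl addr_ge0//.
by apply: sumr_ge0 => i _; exact: B0.
Qed.

(** * Compactness of balls for coordinatewise convergence *)

(* Complex sequences, as pairs of reals, with coordinatewise convergence. *)
Local Notation seqRR := (prod_topology (fun _ : nat => (R * R)%type)).

Definition complex_seq (q : seqRR) : nat -> R[i] := fun k => ((q k).1 +i* (q k).2)%C.

Lemma continuous_normc_sub (z : R[i]) :
  continuous (fun u : R * R => normc (z - (u.1 +i* u.2)%C)).
Proof.
case: z => a b u.
rewrite (_ : (fun _ => _) =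
  (fun u : R * R => Num.sqrt ((a - u.1) ^+ 2 + (b - u.2) ^+ 2)))//.
have sqr_cont (f : R * R -> R) : {for u, continuous f} ->
    {for u, continuous (fun t => f t ^+ 2)}.
  move=> cf; have := @continuous_comp _ _ _ f (fun t => t ^+ 2) u cf.
  by apply; exact: exprn_continuous.
apply: continuous_comp; last exact: sqrt_continuous.
apply: continuousD; apply: sqr_cont.
  by apply: (@continuousB _ _ _ (cst a) fst); [exact: cst_continuous|exact: cvg_fst].
by apply: (@continuousB _ _ _ (cst b) snd); [exact: cst_continuous|exact: cvg_snd].
Qed.

(** Finitely many coordinates are involved. Used with [c] = [v] and x = 0 to close the balls, and
    with [c k] = v_k T_k to make the operator continuous on them. *)
Lemma continuous_partial_dist (c : nat -> R) x N :
  continuous (fun q : seqRR => \sum_(k < N) c k * normc (x k - complex_seq q k)).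
Proof.
apply: continuous_big => [|k _ q]; first exact: add_continuous.
apply: continuousM; first exact: cst_continuous.
have := @continuous_comp _ _ _ (fun p : seqRR => p k)
  (fun u : R * R => normc (x k - (u.1 +i* u.2)%C)) q.
by apply; [exact: (@proj_continuous _ (fun=> (R * R)%type)) | exact: continuous_normc_sub].
Qed.

(** The ball is a subset of the product space, so that it carries the topology in which it is
    compact. *)
Definition l1_ball (r : R) : set seqRR :=
  [set q | (l1sum v (complex_seq q) <= r%:E)%E].

(** A series of nonnegative terms is at most [r] exactly when its partial sums are; each such
    condition is closed. *)
Lemma l1_ball_partialE r : l1_ball r = \bigcap_N
  [set q : seqRR | \sum_(k < N) v k * normc ((0 : nat -> R[i]) k - complex_seq q k) <= r].
Proof.
have pE N (q : seqRR) : ((\sum_(k < N) v k * normc ((0 : nat -> R[i]) k - complex_seq q k))%:E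
    = \sum_(0 <= k < N) (v k * normc (complex_seq q k))%:E)%E.
  by rewrite big_mkord sumEFin; congr EFin; apply: eq_bigr => k _; rewrite sub0r normcN.
apply/seteqP; split=> q /= qr.
  move=> N _ /=; rewrite -lee_fin pE (le_trans _ qr)//.
  by apply: nneseries_lim_ge => *; exact: weight_normc_ge0.
apply: lime_le; first by apply: is_cvg_nneseries => *; exact: weight_normc_ge0.
by apply: nearW => N; rewrite -pE lee_fin; exact: qr.
Qed.

Lemma closed_l1_ball r : closed (l1_ball r).
Proof.
rewrite l1_ball_partialE; apply: closed_bigI => N _.
apply: (@closed_comp _ _ (fun q : seqRR => _) [set t : R | t <= r]); last exact: closed_le.
by move=> q _; exact: continuous_partial_dist.
Qed.

Lemma normc_Re_le (a b : R) : `|a| <= normc (a +i* b)%C.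
Proof. by rewrite /= -sqrtr_sqr ler_wsqrtr// lerDl sqr_ge0. Qed.

Lemma normc_Im_le (a b : R) : `|b| <= normc (a +i* b)%C.
Proof. by rewrite /= -sqrtr_sqr ler_wsqrtr// lerDr sqr_ge0. Qed.

(** Coordinate k of a point of the ball has modulus at most [r / v k], so the ball is a closed part
    of a product of compact squares. *)
Lemma compact_l1_ball r : compact (l1_ball r).
Proof.
pose J k : set R := `[- (r / v k), r / v k]%classic.
apply: (@subclosed_compact seqRR _ [set q | forall k, (J k `*` J k) (q k)]).
- exact: closed_l1_ball.
- apply: (@tychonoff _ (fun=> (R * R)%type) (fun k => J k `*` J k)) => k.
  by apply: compact_setX; exact: segment_compact.
move=> q qr k.
have qk : normc (complex_seq q k) <= r / v k.
  rewrite ler_pdivlMr ?weight_gt0// mulrC -lee_fin (le_trans _ qr)//.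
  exact: l1sum_coord_le.
split; rewrite /J /= in_itv /= -ler_norml.
  exact: le_trans (normc_Re_le _ _) qk.
exact: le_trans (normc_Im_le _ _) qk.
Qed.

(** * Decay of the tails gives compactness *)

(* Takes the junk value 0 on the sequences outside of [l1 v]. *)
Definition cesaro_seq (vw : cesaro_maps v w) (q : seqRR) : l1 w :=
  cesaro_restr vw (insubd (0 : l1 v) (complex_seq q)).

Lemma l1_ball_insubd r q : l1_ball r q ->
  (insubd (0 : l1 v) (complex_seq q) : nat -> R[i]) = complex_seq q.
Proof.
by move=> qr; rewrite insubdK// inE /= (le_lt_trans qr)// ltry.
Qed.

Lemma cesaro_image_ball vw (r : R) (x : l1 v) : l1norm x <= r ->
  (cesaro_seq vw @` l1_ball r) (cesaro_restr vw x).
Proof.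
move=> xr; pose q : seqRR := fun k => (complex.Re (x k), complex.Im (x k)).
have qE : complex_seq q = x by apply/funext => k; rewrite /complex_seq /=; case: (l1_val _ _).
have qr : l1_ball r q by rewrite /l1_ball /= qE -l1normE lee_fin.
exists q => //; congr (cesaro_restr vw _); apply: val_inj.
by rewrite /= (l1_ball_insubd _ _ qr) qE.
Qed.

(** The estimate for the difference of two points is cut at [N]: the far tails are small against the
    norm bound 2r, and the first [N] coordinates are close by coordinatewise convergence. *)
Lemma continuous_cesaro_ball vw r : 0 < r ->
  weighted_tail v w n @[n --> \oo] --> 0%E ->
  {within l1_ball r, continuous (cesaro_seq vw)}.
Proof.
move=> r0 tail0; apply/subspace_continuousP => p pr.
have tail_fin k : weighted_tail v w k \is a fin_num.
  rewrite ge0_fin_numE ?weighted_tail_ge0//.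
  exact: le_lt_trans (weighted_tail_le_Mvw k) (tail_cvg0_Mvw_lty tail0).
apply/cvgrPdist_lt => _ /complex_gt0[e e0 ->].
(* Chosen so that d times 2r equals e / 2. *)
pose d := e / 2 / (2 * r).
have d0 : 0 < d by rewrite !divr_gt0// mulr_gt0.
have [N _ tail_le] : \forall k \near \oo, (weighted_tail v w k <= d%:E)%E.
  have /fine_cvgP[_ /cvgrPdist_lt/(_ d d0)] := tail0.
  apply: filterS => k /=; rewrite sub0r normrN => /ltW kd.
  by rewrite -(fineK (tail_fin k)) lee_fin (le_trans (ler_norm _) kd).
pose c k := v k * fine (weighted_tail v w k).
have near_p : \forall q \near p,
    \sum_(k < N) c k * normc (complex_seq p k - complex_seq q k) < e / 2.
  have /cvgrPdist_lt/(_ (e / 2)) := @continuous_partial_dist c (complex_seq p) N p.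
  rewrite divr_gt0// => /(_ isT); apply: filterS => q.
  rewrite [X in `|X - _|]big1 => [|k _]; last by rewrite subrr normc0 mulr0.
  by rewrite sub0r normrN => /(le_lt_trans (ler_norm _)).
near=> q.
have qr : l1_ball r q by near: q; exact: withinT.
have qp : \sum_(k < N) c k * normc (complex_seq p k - complex_seq q k) < e / 2.
  by near: q; exact: cvg_within.
rewrite /cesaro_seq -linearB l1_norm_lt -lte_fin l1norm_cesaroE.
set z := (X in cesaro X).
have zE : z = complex_seq p - complex_seq q.
  by rewrite -(l1_ball_insubd _ _ pr) -(l1_ball_insubd _ _ qr).
have z2r : (l1sum v z <= (2 * r)%:E)%E.
  rewrite zE (le_trans (l1sumD _ _ _))// mulr2n mulrDl mul1r EFinD leeD//.
  by rewrite -scaleN1r l1sumZ normcN normc1 mul1e.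
have term_ge0 k : (0 <= (v k * normc (z k))%:E * weighted_tail v w k)%E.
  by rewrite mule_ge0 ?weight_normc_ge0 ?weighted_tail_ge0.
have far_le :
    (\sum_(N <= k <oo) (v k * normc (z k))%:E * weighted_tail v w k <= (e / 2)%:E)%E.
  apply: (@le_trans _ _ (d%:E * \sum_(N <= k <oo) (v k * normc (z k))%:E)%E).
    rewrite -nneseriesZl; last by move=> *; exact: weight_normc_ge0.
    rewrite [leLHS]eseries_cond [leRHS]eseries_cond; apply: lee_nneseries => //.
    by move=> k /= Nk; rewrite muleC lee_wpmul2r ?weight_normc_ge0 ?tail_le.
  apply: (@le_trans _ _ (d%:E * l1sum v z)%E).
    apply: lee_wpmul2l; first by rewrite lee_fin ltW.
    rewrite /l1sum [leLHS]eseries_cond.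
    by apply: subset_lee_nneseries => // *; exact: weight_normc_ge0.
  have -> : (e / 2)%:E = (d%:E * (2 * r)%:E)%E.
    by rewrite -EFinM /d divfK// gt_eqF// mulr_gt0.
  by apply: lee_wpmul2l => //; rewrite lee_fin ltW.
rewrite (le_lt_trans (l1sum_cesaro_le _))// (@nneseries_split _ _ 0 N)//.
(* The near part is strictly below e / 2 and the far part at most e / 2; the strict sum needs the
   far part finite. *)
rewrite add0n [e]splitr EFinD; apply: lte_leD => //.
  rewrite ge0_fin_numE; first exact: le_lt_trans far_le (ltry _).
  exact: nneseries_ge0.
rewrite big_mkord (eq_bigr (fun k : 'I_N =>
    (c k * normc (complex_seq p k - complex_seq q k))%:E)).
  by rewrite sumEFin lte_fin.
by move=> k _; rewrite /c zE mulrAC [RHS]EFinM fineK.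
Unshelve. all: by end_near. Qed.

Lemma tail_cvg0_compact :
  weighted_tail v w n @[n --> \oo] --> 0%E -> cesaro_compact v w.
Proof.
move=> tail0; have vw := Mvw_lty_maps (tail_cvg0_Mvw_lty tail0).
exists vw => B /pinfty_ex_gt0[_ /complex_gt0[r r0 ->] Br].
exists (cesaro_seq vw @` l1_ball r).
  move=> _ [x Bx <-]; apply: cesaro_image_ball.
  by have := Br x Bx; rewrite /= l1_normE lecR.
have cK : compact (cesaro_seq vw @` l1_ball r).
  apply: continuous_compact; [exact: continuous_cesaro_ball|exact: compact_l1_ball].
(* Precompactness asks for a superset both compact and closed; closedness follows because l1(w) is
   Hausdorff. *)
by split=> //; apply: compact_closed => //; exact: norm_hausdorff.
Qed.

End cesaro_l1.

Theorem proposition2p2 (R : realType) (v w : weight R) :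
  [/\ cesaro_continuous v w <-> (Mvw v w < +oo)%E,
      (forall vw : cesaro_maps v w, continuous (cesaro_restr vw) ->
         opnorm (cesaro_restr vw) = Mvw v w)
    & cesaro_compact v w <-> weighted_tail v w n @[n --> \oo] --> 0%E].
Proof.
split.
- split=> [[vw]|Moo]; first exact: continuous_Mvw_lty.
  by exists (Mvw_lty_maps _ _ Moo); exact: Mvw_lty_continuous.
- by move=> vw _; exact: opnorm_cesaro.
- by split; [exact: compact_tail_cvg0 | exact: tail_cvg0_compact].
Qed.
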